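(* Let $(\Gamma,a)$ be a weighted graph which satisfies the Green function estimate $(\mathbf{GE}_\gamma)$ for some $\gamma>0$, with constants $0<C_i\le C_s<\infty$. Then the graph is connected, transient, and the weak Harnack inequality $\mathbf{wH}(C)$ holds with $C=2^\gamma\,\frac{C_s}{C_i}$.
   Context: A weighted graph $(\Gamma,a)$ is a countably infinite set $\Gamma$ with a symmetric function $a:\Gamma\times\Gamma\to[0,\infty)$ such that $\pi(x):=\sum_{y\in\Gamma}a(x,y)>0$ for all $x$. Write $x\sim y$ if $a(x,y)>0$; $(\Gamma,\sim)$ is always assumed to be an infinite, locally finite graph without multiple edges. $D(x,y)$ is the graph distance in $(\Gamma,\sim)$ ($=\infty$ if there is no path), and $B(x,R)=\{y:D(x,y)<R\}$. The random walk is the Markov chain $(X_k)_{k\ge 0}$ with transition probabilities $p(x,y)=a(x,y)/\pi(x)$, with law $P_x$ started at $x$. The Green function is $G(x,y)=\sum_{k\ge0}P_x(X_k=y)$; the walk (graph) is transient if $G(x,y)<\infty$ for all $x,y$ (recurrent if $G(x,y)=\infty$ for some $x,y$). $(\mathbf{GE}_\gamma)$, $\gamma>0$: there are constants $0<C_i\le C_s<\infty$ and, for all $z\in\Gamma$, there is $R_z<\infty$ such that for all $x,y\in\Gamma$ with $D(x,y)\ge R_x\wedge R_y$ (minimum), $$\frac{C_i}{D(x,y)^\gamma}\le G(x,y)\le\frac{C_s}{D(x,y)^\gamma}.$$ The bounds are understood as positive real numbers, i.e. it is part of the condition that $D(x,y)<\infty$ for such pairs. For $A\subset\Gamma$, $\partial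 A=\{y\notin A:\exists x\in A,\ x\sim y\}$, $\overline A=A\cup\partial A$; $u:\overline A\to\mathbb R$ is harmonic in $A$ if $\sum_{y\sim x}p(x,y)(u(y)-u(x))=0$ for all $x\in A$. $(\Gamma,a)$ satisfies $\mathbf{wH}(C)$, where $C\ge1$, if for all $x\in\Gamma$ and all $R>0$ there is $R'=R'(x,R)\ge R$ such that for any positive function $u$ harmonic on $B(x,R')$, $\max_{B(x,R)}u\le C\min_{B(x,R)}u$. *)

(* Defs.v *)
From HB Require Import structures.
From mathcomp Require Import all_boot all_order all_algebra.
From mathcomp Require Import all_classical all_reals all_analysis.

Set Implicit Arguments.
Unset Strict Implicit.
Unset Printing Implicit Defensive.

Import Order.TTheory GRing.Theory Num.Theory.

Local Open Scope classical_set_scope.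
Local Open Scope ring_scope.

(* Weighted graphs on a countable vertex type. Loops (a x x > 0) are allowed
   and connectedness is not assumed. By [wg_locally_finite], the finitely
   supported sum in [wg_pi_gt0] is the full sum over all vertices. *)
Record weighted_graph (R : realType) (V : countType) := WeightedGraph {
  weight :> V -> V -> R;
  wg_infinite : infinite_set [set: V];
  wg_ge0 : forall x y, 0 <= weight x y;
  wg_sym : forall x y, weight x y = weight y x;
  wg_locally_finite : forall x, finite_set [set y | 0 < weight x y];
  wg_pi_gt0 : forall x, 0 < \sum_(y \in [set: V]) weight x y
}.

Section Graph.
Context {R : realType} {V : countType}.
Variable a : weighted_graph R V.

Definition vertex_weight (x : V) : R := \sum_(y \in [set: V]) a x y.

Definition adj : rel V := [rel x y | 0 < a x y].

Definition walk_of_length (n : nat) (x y : V) : Prop :=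
  exists s : seq V, [/\ path adj x s, last x s = y & size s = n].

Definition graph_connected : Prop :=
  forall x y, exists n, walk_of_length n x y.

(* The infimum of the empty set is +oo, the value when there is no path. *)
Definition dist (x y : V) : \bar R :=
  ereal_inf [set (n%:R)%:E | n in [set n : nat | walk_of_length n x y]].

Definition gball (x : V) (r : R) : set V := [set y | (dist x y < r%:E)%E].

Definition boundary (A : set V) : set V :=
  [set y | ~ A y /\ exists2 x, A x & adj x y].

Definition gclosure (A : set V) : set V := A `|` boundary A.

Definition trans_prob (x y : V) : R := a x y / vertex_weight x.

(* A function on [gclosure A] is represented by a function on all of V, whose
   values outside [gclosure A] are irrelevant here. *)
Definition harmonic_in (A : set V) (u : V -> R) : Prop :=
  forall x, A x ->
    \sum_(y \in [set y | adj x y]) trans_prob x y * (u y - u x) = 0.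

(* The balls are finite and, for r > 0, nonempty, so that the supremum and
   infimum below are the maximum and minimum of u over the ball. *)
Definition weak_harnack (C : R) : Prop :=
  1 <= C /\
  forall (x : V) (r : R), 0 < r ->
    exists2 r' : R, r <= r' &
      forall u : V -> R,
        (forall y, gclosure (gball x r') y -> 0 < u y) ->
        harmonic_in (gball x r') u ->
        sup (u @` gball x r) <= C * inf (u @` gball x r).

Section Walk.
Context {d : measure_display} {Omega : measurableType d}.
Variables (P : V -> probability Omega R) (X : nat -> Omega -> V).

(* (X_k) is, under each P x, the Markov chain started at x with transition
   probabilities [trans_prob]. V carries the discrete sigma-algebra, and the
   Markov property is written without conditioning, as
   P_x(X_0 = w_0, ..., X_{n+1} = w_{n+1})
     = P_x(X_0 = w_0, ..., X_n = w_n) p(w_n, w_{n+1}). *)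
Definition is_random_walk : Prop :=
  [/\ forall k y, measurable (X k @^-1` [set y]),
      forall x, P x (X 0%N @^-1` [set x]) = 1%E &
      forall (x : V) (n : nat) (w : nat -> V),
        P x [set t | forall i, (i <= n.+1)%N -> X i t = w i] =
        (P x [set t | forall i, (i <= n)%N -> X i t = w i]
          * (trans_prob (w n) (w n.+1))%:E)%E].

Definition green (x y : V) : \bar R :=
  (\sum_(0 <= k <oo) P x (X k @^-1` [set y]))%E.

Definition transient : Prop := forall x y, (green x y < +oo)%E.

(* The bounds C / D(x,y)^gamma must be positive real numbers, hence the
   requirement 0 < D(x,y) < +oo. *)
Definition green_estimate (gamma Ci Cs : R) : Prop :=
  exists rad : V -> R, forall x y : V,
    ((Num.min (rad x) (rad y))%:E <= dist x y)%E ->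
    [/\ (0 < dist x y < +oo)%E,
        ((Ci / fine (dist x y) `^ gamma)%:E <= green x y)%E &
        (green x y <= (Cs / fine (dist x y) `^ gamma)%:E)%E].

End Walk.
End Graph.

(* Main.v *)
(* Connectedness is part of GE_gamma, since the pairs at infinite distance
   satisfy its hypothesis. Any vertex z reaches a vertex w far from x with
   positive probability, so G(x,z) is bounded by a multiple of G(x,w) < oo.
   For the Harnack inequality, let A and B be the closed ball of radius N and
   the open ball of radius M >> N >> R around x. Sweeping u onto A gives a
   function v with v = u on A, v = 0 off B, and v - P v = f >= 0 supported on
   the sphere S of radius N. By the minimum principle on B, the potential
   sum_s f(s) G(.,s) exceeds v by at most eps * sum_s f(s), where eps bounds G
   between S and the complement of B. On B(x,R) the kernels G(.,s), s in S, are
   comparable up to ((N+R)/(N-R))^gamma * Cs/Ci, and N > 3R leaves enough slack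
   below 2^gamma to absorb eps. *)
Require Import Defs.
From mathcomp Require Import all_boot all_order all_algebra.
From mathcomp Require Import finmap.
From mathcomp Require Import all_classical all_reals all_analysis.
From mathcomp Require Import zify ring lra.

Import Order.TTheory GRing.Theory Num.Theory numFieldNormedType.Exports.

Local Open Scope classical_set_scope.
Local Open Scope ring_scope.

Set Implicit Arguments.
Unset Strict Implicit.
Unset Printing Implicit Defensive.

(** * Extrema of real functions on finite sets *)

Lemma finite_set_min {R : realType} {T : choiceType} (f : T -> R) (B : set T) :
  finite_set B -> B !=set0 -> exists2 z, B z & forall t, B t -> f z <= f t.
Proof.
move=> /finite_fsetP[F ->] [z0 z0F].
case: (@Order.TotalTheory.arg_minP _ _ _ [` z0F]%fset xpredT
  (fun i => f (fsval i))) => // z _ zmin.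
by exists (fsval z); [exact: fsvalP|move=> t tF; exact: (zmin [` tF]%fset)].
Qed.

Lemma finite_set_ubound {R : realType} {T : choiceType} (f : T -> R) (B : set T) :
  finite_set B -> exists n : nat, forall t, B t -> f t <= n%:R.
Proof.
move=> finB; have [[z Bz]|B0] := pselect (B !=set0); last first.
  by exists 0%N => t Bt; case: B0; exists t.
have [m Bm mmax] := finite_set_min (fun t => - f t) finB (ex_intro _ z Bz).
exists (Num.truncn (f m)).+1 => t /mmax; rewrite lerN2 => /le_trans -> //.
exact/ltW/truncnS_gt.
Qed.

(** * Walks, neighbours and transition probabilities *)

Section Graph.
Context {R : realType} {V : countType}.
Variable a : weighted_graph R V.
Implicit Types (x y z : V) (u v w : V -> R).

Lemma adj_sym x y : adj a x y = adj a y x.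
Proof. by rewrite /adj /= wg_sym. Qed.

Lemma walk0 x y : walk_of_length a 0 x y <-> x = y.
Proof.
split=> [[s [_ <- /size0nil ->]] //|->].
by exists [::].
Qed.

Lemma walkS n x y :
  walk_of_length a n.+1 x y <-> exists2 z, adj a x z & walk_of_length a n z y.
Proof.
split=> [[[|z s] [//= + sy [sn]]]|[z xz [s [zs sy sn]]]].
  by move=> /andP[xz zs]; exists z => //; exists s.
by exists (z :: s); split=> //=; [exact/andP|rewrite sn].
Qed.

Lemma walk_cat m n x y z : walk_of_length a m x y -> walk_of_length a n y z ->
  walk_of_length a (m + n) x z.
Proof.
elim: m x => [|m IH] x; first by move/walk0 => ->.
move=> /walkS[t xt ty] yz; rewrite addSn; apply/walkS; exists t => //.
exact: IH.
Qed.

Lemma walk1 x y : adj a x y -> walk_of_length a 1 x y.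
Proof. by move=> xy; apply/walkS; exists y => //; apply/walk0. Qed.

Lemma walk_sym n x y : walk_of_length a n x y -> walk_of_length a n y x.
Proof.
elim: n x => [|n IH] x; first by move/walk0 => ->; apply/walk0.
move=> /walkS[t xt ty]; rewrite -addn1; apply: walk_cat (IH _ ty) _.
by apply: walk1; rewrite adj_sym.
Qed.

Definition nbrs x : seq V := fset_set [set y | adj a x y].

Lemma mem_nbrs x y : (y \in nbrs x) = adj a x y.
Proof.
by rewrite in_fset_set; [apply: asboolb|exact: wg_locally_finite].
Qed.

Lemma vertex_weightE x : vertex_weight a x = \sum_(y <- nbrs x) a x y.
Proof.
apply: fsbigTE => y.
rewrite -[y \in _]/(y \in nbrs x) mem_nbrs /adj /= -leNgt => le0.
by apply/eqP; rewrite eq_le le0 wg_ge0.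
Qed.

Lemma vertex_weight_gt0 x : 0 < vertex_weight a x.
Proof. exact: wg_pi_gt0. Qed.

Lemma trans_prob_ge0 x y : 0 <= trans_prob a x y.
Proof. by rewrite divr_ge0 ?wg_ge0// ltW// vertex_weight_gt0. Qed.

Lemma trans_prob_gt0 x y : (0 < trans_prob a x y) = adj a x y.
Proof. by rewrite pmulr_lgt0 // invr_gt0 vertex_weight_gt0. Qed.

Lemma trans_prob_sum x : \sum_(y <- nbrs x) trans_prob a x y = 1.
Proof.
by rewrite -mulr_suml -vertex_weightE divff // gt_eqF // vertex_weight_gt0.
Qed.

(** * The Markov operator and its iterates *)

Definition markov_op u x : R := \sum_(y <- nbrs x) trans_prob a x y * u y.

Lemma ler_markov_op u v x : (forall y, adj a x y -> u y <= v y) ->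
  markov_op u x <= markov_op v x.
Proof.
move=> uv; rewrite /markov_op big_seq [leRHS]big_seq.
apply: ler_sum => y; rewrite mem_nbrs => xy.
by rewrite ler_wpM2l ?trans_prob_ge0 ?uv.
Qed.

Lemma eq_markov_op u v x : (forall y, adj a x y -> u y = v y) ->
  markov_op u x = markov_op v x.
Proof.
by move=> uv; apply/eqP; rewrite eq_le !ler_markov_op // => y /uv ->.
Qed.

Lemma markov_op_cst c x : markov_op (fun=> c) x = c.
Proof. by rewrite /markov_op -mulr_suml trans_prob_sum mul1r. Qed.

Lemma markov_opZ c u x : markov_op (fun y => c * u y) x = c * markov_op u x.
Proof. by rewrite mulr_sumr; apply: eq_bigr => y _; rewrite mulrCA. Qed.

Lemma markov_opB u v x :
  markov_op (fun y => u y - v y) x = markov_op u x - markov_op v x.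
Proof. by rewrite -sumrB; apply: eq_bigr => y _; rewrite mulrBr. Qed.

Lemma markov_op_sum (I : Type) (s : seq I) (F : I -> V -> R) x :
  markov_op (fun y => \sum_(i <- s) F i y) x = \sum_(i <- s) markov_op (F i) x.
Proof.
rewrite exchange_big; apply: eq_bigr => y _; exact: mulr_sumr.
Qed.

Lemma harmonic_markov_op (A : set V) u x :
  harmonic_in a A u -> A x -> markov_op u x = u x.
Proof.
move=> /[apply]; rewrite fsbig_finite; last exact: wg_locally_finite.
under eq_bigr do rewrite mulrBr.
by rewrite sumrB -mulr_suml trans_prob_sum mul1r => /subr0_eq.
Qed.

(** The [k]-step transition probability, split at the first step; [prob_step_prob] identifies it
    with the law of [X k]. *)
Fixpoint step_prob (k : nat) x y : R :=
  if k is k'.+1 then markov_op (step_prob k' ^~ y) x else (x == y)%:R.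

Lemma step_prob_ge0 k x y : 0 <= step_prob k x y.
Proof.
elim: k x => [|k IH] x /=; first exact: ler0n.
by rewrite sumr_ge0 // => z _; rewrite mulr_ge0 ?trans_prob_ge0.
Qed.

(** Half of Chapman-Kolmogorov: only the walks that are at [y] at time [k] are kept. *)
Lemma step_prob_cat k m x y z :
  step_prob k x y * step_prob m y z <= step_prob (k + m) x z.
Proof.
elim: k x => [|k IH] x /=.
  by case: eqVneq => [->|_]; rewrite ?mul1r// mul0r step_prob_ge0.
rewrite mulrC -markov_opZ; apply: ler_markov_op => t _.
by rewrite mulrC.
Qed.

Lemma step_prob_gt0 n x y : walk_of_length a n x y -> 0 < step_prob n x y.
Proof.
elim: n x => [|n IH] x; first by move/walk0 => ->; rewrite /= eqxx.
move=> /walkS[z xz zy]; apply: lt_le_trans (step_prob_cat 1 n x z y).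
rewrite mulr_gt0 ?IH //= /markov_op (bigD1_seq z) ?mem_nbrs ?fset_uniq //=.
rewrite eqxx mulr1 ltr_pwDl ?trans_prob_gt0 // sumr_ge0 // => t _.
by rewrite mulr_ge0 ?trans_prob_ge0.
Qed.

(** * Graph distance and the minimum principle on a connected graph *)

Hypothesis conn : graph_connected a.

Lemma graph_dist_subproof x y : exists n, `[< walk_of_length a n x y >].
Proof. by have [n w] := conn x y; exists n; apply/asboolP. Qed.

(** Connectedness makes the distance a natural number, which spares the estimates the extended
    reals. *)
Definition graph_dist x y : nat := ex_minn (graph_dist_subproof x y).

Lemma graph_dist_walk x y : walk_of_length a (graph_dist x y) x y.
Proof. by rewrite /graph_dist; case: ex_minnP => n /asboolP. Qed.

Lemma graph_dist_min n x y : walk_of_length a n x y -> (graph_dist x y <= n)%N.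
Proof.
by rewrite /graph_dist; case: ex_minnP => m _ + w; apply; apply/asboolP.
Qed.

Lemma distE x y : dist a x y = ((graph_dist x y)%:R)%:E.
Proof.
apply/eqP; rewrite eq_le; apply/andP; split.
  by apply: ereal_inf_lbound; exists (graph_dist x y) => //; exact: graph_dist_walk.
apply: le_ereal_inf_tmp => _ [n w <-].
by rewrite lee_fin ler_nat graph_dist_min.
Qed.

Lemma gballE x r : gball a x r = [set y | (graph_dist x y)%:R < r].
Proof. by apply/seteqP; split=> y; rewrite /gball /= distE lte_fin. Qed.

Lemma graph_distxx x : graph_dist x x = 0%N.
Proof. by apply/eqP; rewrite -leqn0 graph_dist_min //; apply/walk0. Qed.

Lemma graph_dist_sym x y : graph_dist x y = graph_dist y x.
Proof.
by apply/eqP; rewrite eqn_leq !graph_dist_min //; apply: walk_sym;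
  exact: graph_dist_walk.
Qed.

Lemma graph_dist_triangle y x z :
  (graph_dist x z <= graph_dist x y + graph_dist y z)%N.
Proof. by apply: graph_dist_min; apply: walk_cat; exact: graph_dist_walk. Qed.

Lemma graph_dist_adj x y z :
  adj a y z -> (graph_dist x z <= (graph_dist x y).+1)%N.
Proof.
move=> yz; rewrite -addn1; apply: graph_dist_min.
by apply: walk_cat (walk1 yz); exact: graph_dist_walk.
Qed.

Lemma finite_walks x n : finite_set [set y | walk_of_length a n x y].
Proof.
elim: n x => [|n IH] x.
  by apply: sub_finite_set (finite_set1 x) => y /walk0 ->.
apply: (@sub_finite_set _ _
  (\bigcup_(z in [set z | adj a x z]) [set y | walk_of_length a n z y])).
  by move=> y /walkS[z xz zy]; exists z.
by apply: bigcup_finite => [|z _]; [exact: wg_locally_finite|exact: IH].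
Qed.

Lemma finite_graph_ball x n : finite_set [set y | (graph_dist x y < n)%N].
Proof.
apply: (@sub_finite_set _ _
  (\bigcup_(k in `I_n) [set y | walk_of_length a k x y])).
  by move=> y xy; exists (graph_dist x y) => //; exact: graph_dist_walk.
by apply: bigcup_finite => // k _; exact: finite_walks.
Qed.

(** Balls are finite by local finiteness, and the vertex set is infinite. *)
Lemma ex_far_vertex x n : exists y, (n <= graph_dist x y)%N.
Proof.
apply: contrapT => /forallNP near; apply: (wg_infinite a).
apply: sub_finite_set (finite_graph_ball x n) => y _ /=.
by rewrite ltnNge; apply/negP/near.
Qed.

(* The set where w attains its minimum is closed under taking neighbors and
   hence, by connectedness, reaches a vertex outside of B. *)
Lemma minimum_principle (B : set V) (w : V -> R) : finite_set B ->
  (forall y, B y -> markov_op w y <= w y) -> (forall y, ~ B y -> 0 <= w y) ->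
  forall y, 0 <= w y.
Proof.
move=> finB sup wB y; rewrite leNgt; apply/negP => wy0.
have By : B y by apply: contrapT => /wB; rewrite leNgt wy0.
have [z0 Bz0 minz0] := finite_set_min w finB (ex_intro _ y By).
have wz0 : w z0 < 0 by exact: le_lt_trans (minz0 _ By) wy0.
have gmin t : w z0 <= w t.
  by have [/minz0//|/wB] := pselect (B t); apply: le_trans; exact: ltW.
have prop t s : w t = w z0 -> adj a t s -> w s = w z0.
  move=> wt ts; have Bt : B t.
    by apply: contrapT => /wB; rewrite wt leNgt wz0.
  (* The function [w - w z0] is nonnegative and its average over the neighbours of [t] is at most 0,
     so it vanishes at each of them. *)
  have : markov_op (fun r => w r - w z0) t <= 0.
    by rewrite markov_opB markov_op_cst subr_le0 -wt sup.
  rewrite /markov_op (bigD1_seq s) ?mem_nbrs ?fset_uniq //= => le0.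
  apply/eqP; rewrite eq_le gmin andbT -subr_le0.
  rewrite -(pmulr_rle0 _ (_ : 0 < trans_prob a t s)) ?trans_prob_gt0 //.
  apply: le_trans le0; rewrite lerDl sumr_ge0 // => r _.
  by rewrite mulr_ge0 ?trans_prob_ge0 // subr_ge0.
have [t nBt] : exists t, ~ B t.
  apply: contrapT => /forallNP nB; apply: (wg_infinite a).
  by apply: sub_finite_set finB => t _; apply: contrapT => /nB.
have [n] := conn z0 t.
(* Generalizing one side of this equation gives the invariant of the induction along the walk to
   [t]: the current vertex carries the minimal value. *)
have: w z0 = w z0 by [].
elim: n {1 3}z0 => [|n IH] s ws.
  by move/walk0 => st; have := wB _ nBt; rewrite -st ws leNgt wz0.
by move=> /walkS[r sr rt]; apply: IH rt; exact: prop sr.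
Qed.
End Graph.

(** * The law of the random walk and the Green function *)

Lemma probability_setI_ae (d : measure_display) (T : measurableType d) (R : realType)
    (mu : probability T R) (A E B : set T) :
  measurable A -> measurable E -> measurable B -> A `<=` E ->
  mu (E `\` B) = 0%E -> mu A = mu (A `&` B).
Proof.
move=> mA mE mB AE EB0.
have -> : mu A = (mu (A `\` B) + mu (A `&` B))%E by exact: measureDI.
rewrite [X in (X + _)%E](_ : _ = 0%E) ?add0e //.
apply/eqP; rewrite eq_le measure_ge0 andbT -EB0.
by apply: le_measure; rewrite ?inE; [exact: measurableD..|exact: setSD].
Qed.

Section Walk.
Context {R : realType} {V : countType}.
Variable a : weighted_graph R V.
Context {d : measure_display} {Omega : measurableType d}.
Variables (P : V -> probability Omega R) (X : nat -> Omega -> V).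
Hypothesis hX : is_random_walk a P X.
Implicit Types x y z : V.

Definition cylinder n (w : nat -> V) : set Omega :=
  [set t | forall i, (i <= n)%N -> X i t = w i].

Let measurable_X k y : measurable (X k @^-1` [set y]).
Proof. by have [+ _ _] := hX; apply. Qed.

Lemma measurable_cylinder n w : measurable (cylinder n w).
Proof.
rewrite (_ : cylinder n w = \bigcap_(i in `I_n.+1) X i @^-1` [set w i]).
  by apply: bigcap_measurable => [|k _]; [exists 0%N|exact: measurable_X].
by apply/seteqP; split=> t wt i iln; exact: wt.
Qed.

Lemma cylinder_step n w v :
  cylinder n.+1 (fun i => if (i <= n)%N then w i else v) =
  cylinder n w `&` X n.+1 @^-1` [set v].
Proof.
apply/seteqP; split=> [t wt|t [wt Xv] i].
  split; last by rewrite /= (wt n.+1) // ltnn.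
  by move=> i ilen; rewrite wt ?ilen // leqW.
by rewrite leq_eqVlt ltnS => /predU1P[->|ilen]; rewrite ?ltnn // ilen; exact: wt.
Qed.

Lemma prob_cylinder_step n w v x :
  P x (cylinder n w `&` X n.+1 @^-1` [set v]) =
  (P x (cylinder n w) * (trans_prob a (w n) v)%:E)%E.
Proof.
rewrite -cylinder_step; have [_ _ ->] := hX; rewrite leqnn ltnn.
congr (P x _ * _)%E; apply/seteqP; split=> t wt i ilen; last by rewrite ilen wt.
by rewrite wt // ilen.
Qed.

(** Induction on [k] for all [n] and [w]: the event is split by the vertex [v] visited at time
    [n.+1], and the induction hypothesis is applied to the path [w] prolonged by [v]. *)
Lemma prob_cylinder_step_prob k n w x y :
  P x (cylinder n w `&` X (n + k)%N @^-1` [set y]) =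
  (P x (cylinder n w) * (step_prob a k (w n) y)%:E)%E.
Proof.
elim: k n w => [|k IH] n w.
  rewrite addn0 /=; case: eqVneq => [<-|wy]; rewrite ?mule1 ?mule0.
    by congr (P x _); apply: setIidl => t; exact.
  rewrite -(measure0 (P x)); congr (P x _); apply/seteqP; split=> // t /= [wt].
  by rewrite wt // => /eqP; rewrite (negPf wy).
set E := cylinder n w; set F := X _ @^-1` _.
have mE : measurable E by exact: measurable_cylinder.
have mF : measurable F by exact: measurable_X.
pose N := [set v | adj a (w n) v]; pose Ev v := E `&` X n.+1 @^-1` [set v].
have mEv v : measurable (Ev v) by exact: measurableI.
have finN : finite_set N by exact: wg_locally_finite.
have mU : measurable (\bigcup_(v in N) Ev v) by exact: fin_bigcup_measurable.
have trivEv (G : set Omega) : trivIset N (fun v => Ev v `&` G).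
  by move=> u v _ _ [t [[[_ <-] _] [[_ <-] _]]].
have fE : (P x E = (fine (P x E))%:E)%E by rewrite fineK // fin_num_measure.
(* The transition probabilities to the finitely many neighbours of [w n] sum to 1, so the events
   [Ev v] exhaust the mass of [E] and what they leave of [E] is null. *)
have PU : P x (\bigcup_(v in N) Ev v) = P x E.
  have := trivEv setT; under eq_fun do rewrite setIT.
  move=> triv; rewrite measure_fin_bigcup //.
  rewrite (eq_fsbigr (fun v => P x E * (trans_prob a (w n) v)%:E)%E); last first.
    by move=> v _; exact: prob_cylinder_step.
  rewrite fsbig_finite // fE.
  under eq_bigr do rewrite -EFinM.
  by rewrite sumEFin -mulr_sumr trans_prob_sum mulr1.
have EU0 : P x (E `\` \bigcup_(v in N) Ev v) = 0%E.
  have UE : \bigcup_(v in N) Ev v `<=` E by move=> t [v _ []].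
  have DE : P x E = (P x (E `\` \bigcup_(v in N) Ev v) +
      P x (\bigcup_(v in N) Ev v))%E.
    by rewrite -{2}(setIidr UE); exact: measureDI.
  have := congr1 (fun p => p - P x E)%E DE; rewrite PU.
  by rewrite addeK ?fin_num_measure // subee ?fin_num_measure.
have -> : P x (E `&` F) = P x (E `&` F `&` \bigcup_(v in N) Ev v).
  by apply: probability_setI_ae EU0 => //; exact: measurableI.
rewrite (_ : _ `&` _ = \bigcup_(v in N) (Ev v `&` F)); last first.
  apply/seteqP; split=> [t [[Et Ft] [v Nv Evt]]|t [v Nv [[Et Xt] Ft]]].
    by exists v.
  by split => //; exists v.
rewrite measure_fin_bigcup //; last by move=> v _; exact: measurableI.
transitivity (\sum_(v \in N)
   (P x E * (trans_prob a (w n) v * step_prob a k v y)%:E))%E.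
  apply: eq_fsbigr => v _.
  have := IH n.+1 (fun i => if (i <= n)%N then w i else v).
  rewrite cylinder_step prob_cylinder_step ltnn -/E -/(Ev v) addSnnS -/F => IHv.
  by rewrite EFinM muleA.
rewrite fsbig_finite // fE /=.
under eq_bigr do rewrite -EFinM.
by rewrite sumEFin -mulr_sumr.
Qed.

Lemma prob_step_prob k x y :
  P x (X k @^-1` [set y]) = (step_prob a k x y)%:E.
Proof.
have P0 : P x (cylinder 0 (fun=> x)) = 1%E.
  have [_ X0 _] := hX; rewrite -(X0 x); congr (P x _).
  by apply/seteqP; split=> t; [apply|move=> xt i; rewrite leqn0 => /eqP ->].
have := prob_cylinder_step_prob k 0 (fun=> x) x y.
rewrite P0 mul1e add0n => <-.
have mE := measurable_cylinder 0 (fun=> x).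
(* The walk starts at [x] almost surely, so intersecting with the cylinder of length 0 loses no
   mass. *)
rewrite setIC; apply: (probability_setI_ae (E := setT)) => //.
by rewrite setTD probability_setC // P0 subee.
Qed.

Lemma greenE x y : green P X x y = (\sum_(0 <= k <oo) (step_prob a k x y)%:E)%E.
Proof. by apply: eq_eseriesr => k _; rewrite prob_step_prob. Qed.

Lemma green_ge0 x y : (0 <= green P X x y)%E.
Proof. by apply: nneseries_ge0 => k _ _; exact: measure_ge0. Qed.

(** Time 0 contributes the point mass, and the shifted series is averaged over the first step.
    Nonnegative terms allow the sums to be exchanged even when they are infinite. *)
Lemma green_first_step x y : green P X x y =
  ((x == y)%:R%:E +
   \sum_(z <- nbrs a x) (trans_prob a x z)%:E * green P X z y)%E.
Proof.
rewrite greenE nneseries_recl //; last first.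
  by move=> k _; rewrite lee_fin step_prob_ge0.
congr (_ + _)%E; rewrite -nneseries_addn; last first.
  by move=> k; rewrite lee_fin step_prob_ge0.
under eq_eseriesr do rewrite addn1 /= /markov_op -sumEFin.
rewrite nneseries_sum; last first.
  by move=> z k _; rewrite lee_fin mulr_ge0 ?trans_prob_ge0 ?step_prob_ge0.
apply: eq_bigr => z _; rewrite greenE -nneseriesZl // => k _.
by rewrite lee_fin step_prob_ge0.
Qed.

(** Each visit to [y] may be followed by [m] steps to [z]: the series on the right is shifted by [m]
    and its first [m] terms are dropped. *)
Lemma green_cat m x y z :
  (green P X x y * (step_prob a m y z)%:E <= green P X x z)%E.
Proof.
rewrite muleC !greenE -nneseriesZl; last first.
  by move=> k _; rewrite lee_fin step_prob_ge0.
rewrite [leRHS](nneseries_split 0 m); last first.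
  by move=> k _; rewrite lee_fin step_prob_ge0.
rewrite add0n.
apply: (@le_trans _ _ (\sum_(m <= k <oo) (step_prob a k x z)%:E)%E); last first.
  by rewrite leeDr // sume_ge0 // => k _; rewrite lee_fin step_prob_ge0.
rewrite -nneseries_addn; last first.
  by move=> k; rewrite lee_fin step_prob_ge0.
apply: lee_nneseries => [k _ _|k _].
  by rewrite lee_fin mulr_ge0 ?step_prob_ge0.
by rewrite lee_fin mulrC step_prob_cat.
Qed.

(** If [G(x,y)] were infinite, so would be the left side of [green_cat], since [step_prob a m y z]
    is positive. *)
Lemma green_reach_fin m x y z : walk_of_length a m y z ->
  (green P X x z < +oo)%E -> (green P X x y < +oo)%E.
Proof.
move=> /step_prob_gt0 p0; have := green_cat m x y z.
have := green_ge0 x y; case: (green P X x y) => [r _ _ _| |//]; first exact: ltry.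
by rewrite gt0_mulye ?lte_fin // leye_eq => _ /eqP ->.
Qed.
End Walk.

(** * Balayage and the comparison of values through potentials *)

Section Balayage.
Context {R : realType} {V : countType}.
Variable a : weighted_graph R V.
Implicit Types (x y z : V).

(* v y is the expectation, for the walk started at y, of u at the hitting time
   of A on the event that A is hit before leaving B; the n-th iterate below
   restricts to walks which hit A within n steps. *)
Lemma ex_balayage (A B : set V) (u : V -> R) : A `<=` B ->
  (forall y, gclosure a B y -> 0 <= u y) ->
  (forall y, B y -> markov_op a u y <= u y) ->
  exists v : V -> R, [/\ forall y, A y -> v y = u y,
    forall y, ~ B y -> v y = 0,
    forall y, B y -> ~ A y -> markov_op a v y = v y &
    forall y, gclosure a B y -> v y <= u y].
Proof.
move=> AB u0 sup.
pose it := fix it n y := if y \in A then u y else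
  if n is n'.+1 then if y \in B then markov_op a (it n') y else 0 else 0.
have it_nB n y : ~ B y -> it n y = 0.
  move=> nBy; have /negPf nA : y \notin A by apply/negP => /set_mem/AB.
  by case: n => [|n] /=; rewrite nA // memNset.
have it_ge0 n y : 0 <= it n y.
  elim: n y => [|n IH] y /=;
    (case: ifPn => [/set_mem Ay|_]; first by apply/u0/or_introl/AB) => //.
  case: ifP => // _; apply: sumr_ge0 => z _.
  by rewrite mulr_ge0 ?trans_prob_ge0.
have it_le n y : gclosure a B y -> it n y <= u y.
  elim: n y => [|n IH] y By /=; case: ifPn => // _; first exact: u0.
  case: ifPn => [/set_mem {}By|_]; last exact: u0.
  apply: le_trans (sup _ By); apply: ler_markov_op => z yz; apply: IH.
  have [Bz|nBz] := pselect (B z); first by left.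
  by right; split => //; exists y.
have it_incr n y : it n y <= it n.+1 y.
  elim: n y => [|n IH] y.
    by have := it_ge0 1 y; rewrite /=; case: ifP.
  rewrite [leLHS]/= [leRHS]/=; case: ifP => // _; case: ifP => // _.
  by apply: ler_markov_op => z _; exact: IH.
have it_cvg y : cvgn (it ^~ y).
  apply: nondecreasing_is_cvgn.
    by apply/nondecreasing_seqP => n; exact: it_incr.
  have [By|nBy] := pselect (B y).
    by exists (u y) => _ [n _ <-]; apply: it_le; left.
  by exists 0 => _ [n _ <-]; rewrite it_nB.
exists (fun y => limn (it ^~ y)); split=> [y Ay|y nBy|y By nAy|y By].
- rewrite (_ : it ^~ y = fun=> u y) ?lim_cst //; apply/funext => n.
  by case: n => [|n] /=; rewrite mem_set.
- by rewrite (_ : it ^~ y = fun=> 0) ?lim_cst //; apply/funext => n; exact: it_nB.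
(* On [B] outside [A], [it n.+1] is the average of [it n]; the average is a finite sum, so it
   commutes with the limit. *)
- have lim1 : markov_op a (it n) y @[n --> \oo] -->
      markov_op a (fun z => limn (it ^~ z)) y.
    apply: cvg_big => [|z _]; first exact: add_continuous.
    by apply: cvgM; [exact: cvg_cst|exact: it_cvg].
  have lim2 : markov_op a (it n) y @[n --> \oo] --> limn (it ^~ y).
    rewrite (_ : (fun n => markov_op a (it n) y) = fun n => it n.+1 y).
      by rewrite (cvg_shiftS (it ^~ y)); exact: it_cvg.
    by apply/funext => n /=; rewrite memNset // mem_set.
  exact: (cvg_unique _ lim1 lim2).
- by apply: limr_le => //; apply: nearW => n; exact: it_le.
Qed.

(* On A, u agrees with a function v vanishing outside of B for which f := v - P v
   is nonnegative on S and vanishes on the rest of B. Hence the potential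
   of f exceeds v by a function which is harmonic in B, and which lies between
   0 and eps times the mass of f outside of B. *)
Lemma harnack_of_potential_kernel (g : V -> V -> R) (A B S : set V) (u : V -> R)
    (eps C : R) (y z : V) :
  graph_connected a -> finite_set B -> A `<=` B -> S `<=` A -> 0 <= C ->
  (forall t s, A t -> ~ S t -> adj a t s -> A s) ->
  (forall t s, 0 <= g t s) ->
  (forall t s, markov_op a (g ^~ s) t = g t s - (t == s)%:R) ->
  (forall t s, ~ B t -> S s -> g t s <= eps) ->
  (forall t, gclosure a B t -> 0 <= u t) -> harmonic_in a B u ->
  A y -> A z -> (forall s, S s -> g y s <= C * (g z s - eps)) ->
  u y <= C * u z.
Proof.
move=> conn finB AB SA C0 intA g0 gP geps u0 harm Ay Az gyz.
have Pu t : B t -> markov_op a u t = u t by exact: harmonic_markov_op.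
have [v [vA vB vP vu]] : exists v : V -> R, [/\ forall y, A y -> v y = u y,
    forall y, ~ B y -> v y = 0,
    forall y, B y -> ~ A y -> markov_op a v y = v y &
    forall y, gclosure a B y -> v y <= u y].
  by apply: ex_balayage => // t /Pu ->.
pose f t := v t - markov_op a v t.
pose Sl : seq V := fset_set S.
have SlE t : (t \in Sl) = (t \in S).
  by rewrite in_fset_set //; apply: sub_finite_set finB => s /SA/AB.
(* On [A], [v = u] and [u] equals its own average, so [f] is the average of [u - v], and [v <= u] on
   the closure of [B]. *)
have f0 t : S t -> 0 <= f t.
  move=> /SA At; rewrite subr_ge0 vA // -Pu; last exact: AB.
  apply: ler_markov_op => s ts; apply: vu.
  have [Bs|nBs] := pselect (B s); first by left.
  by right; split=> //; exists t => //; exact: AB.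
pose pot t := \sum_(s <- Sl) f s * g t s.
pose mass := \sum_(s <- Sl) f s.
have potP t : B t -> markov_op a pot t = pot t - f t.
  move=> Bt; rewrite markov_op_sum.
  under eq_bigr do rewrite markov_opZ gP mulrBr.
  rewrite sumrB; congr (_ - _).
  have [St|nSt] := pselect (S t).
    rewrite (bigD1_seq t) ?fset_uniq ?SlE ?mem_set //= eqxx mulr1 big1 ?addr0 //.
    by move=> s /negPf; rewrite eq_sym => ->; rewrite mulr0.
  rewrite big_seq big1 => [|s]; last first.
    rewrite SlE => /set_mem Ss; case: eqP => [ts|_]; last by rewrite mulr0.
    by move: nSt; rewrite ts.
  apply/esym/eqP; rewrite subr_eq0; apply/eqP.
  (* Outside [S] the defect [f] vanishes: off [A] by the construction of [v], and in [A] because all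
     neighbours lie in [A], where [v] is the harmonic function [u]. *)
  have [At|nAt] := pselect (A t); last by rewrite vP.
  rewrite vA // -Pu //; apply: eq_markov_op => s ts.
  by rewrite vA //; exact: intA ts.
have u_le t : A t -> u t <= pot t.
  move=> At; rewrite -vA // -subr_ge0.
  apply: (minimum_principle conn finB (w := fun t => pot t - v t)) => s.
    by move=> Bs; rewrite markov_opB potP // /f; lra.
  move=> nBs; rewrite vB // subr0 /pot big_seq sumr_ge0 // => r.
  by rewrite SlE => /set_mem Sr; rewrite mulr_ge0 ?f0.
have u_ge t : A t -> pot t - eps * mass <= u t.
  move=> At; rewrite -vA // -subr_ge0.
  apply: (minimum_principle conn finB
    (w := fun t => v t - (pot t - eps * mass))) => s.
    move=> Bs; rewrite !markov_opB markov_op_cst potP // /f; lra.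
  move=> nBs; rewrite vB // sub0r oppr_ge0 subr_le0 /pot /mass mulr_sumr.
  rewrite big_seq [leRHS]big_seq; apply: ler_sum => r.
  by rewrite SlE mulrC => /set_mem Sr; rewrite ler_wpM2r ?f0 ?geps.
(* The two bounds on [u] reduce the claim to potentials, which are compared term by term with the
   nonnegative weights [f s]. *)
apply: le_trans (u_le _ Ay) _.
apply: le_trans (_ : C * (pot z - eps * mass) <= _); last by rewrite ler_wpM2l ?u_ge.
rewrite /pot /mass mulr_sumr -sumrB mulr_sumr big_seq [leRHS]big_seq.
apply: ler_sum => s; rewrite SlE => /set_mem Ss.
by rewrite mulrC (mulrC eps) -mulrBr mulrCA mulrC ler_wpM2l ?f0 ?gyz.
Qed.
End Balayage.

(** * Consequences of the Green function estimate *)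

Section GreenEstimate.
Context {R : realType} {V : countType}.
Variable a : weighted_graph R V.
Context {d : measure_display} {Omega : measurableType d}.
Variables (P : V -> probability Omega R) (X : nat -> Omega -> V).
Hypothesis hX : is_random_walk a P X.
Variables (gamma Ci Cs : R).
Hypotheses (gamma_gt0 : 0 < gamma) (Ci_gt0 : 0 < Ci) (Ci_le_Cs : Ci <= Cs).

Lemma green_estimate_connected :
  green_estimate a P X gamma Ci Cs -> graph_connected a.
Proof.
move=> [rad GE] x y; apply: contrapT => nwalk.
have dist_oo : dist a x y = +oo%E.
  rewrite /dist [X in ereal_inf X](_ : _ = set0) ?ereal_inf0 //.
  by apply/seteqP; split=> [l [n w _]|l []]; case: nwalk; exists n.
by have := GE x y; rewrite dist_oo leey ltxx andbF => /(_ isT)[].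
Qed.

Hypothesis conn : graph_connected a.
Variable rad : V -> R.
Hypothesis GE : forall x y,
  ((Num.min (rad x) (rad y))%:E <= dist a x y)%E ->
  [/\ (0 < dist a x y < +oo)%E,
      ((Ci / fine (dist a x y) `^ gamma)%:E <= green P X x y)%E &
      (green P X x y <= (Cs / fine (dist a x y) `^ gamma)%:E)%E].

Local Notation gd := (graph_dist conn).
Let green_fin x y := fine (green P X x y).

Lemma green_estimate_transient : transient P X.
Proof.
move=> x z; have [n radn] : exists n : nat, rad x <= n%:R.
  by exists (Num.truncn (rad x)).+1; exact/ltW/truncnS_gt.
have [w xw] := ex_far_vertex conn x n.
have [m zw] := conn z w.
apply: (green_reach_fin hX zw).
have [|_ _ /le_lt_trans] := GE (x := x) (y := w); last by apply; exact: ltry.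
by rewrite (distE conn) lee_fin ge_min (le_trans radn) // ler_nat.
Qed.

Let greenK x y : (green_fin x y)%:E = green P X x y.
Proof.
by rewrite fineK // ge0_fin_numE ?green_ge0 //; exact: green_estimate_transient.
Qed.

Let green_fin_bounds x y :
  rad x <= (gd x y)%:R \/ rad y <= (gd x y)%:R ->
  [/\ (0 < gd x y)%N, Ci / (gd x y)%:R `^ gamma <= green_fin x y &
      green_fin x y <= Cs / (gd x y)%:R `^ gamma].
Proof.
move=> far; have [|] := GE (x := x) (y := y).
  by rewrite (distE conn) lee_fin ge_min; apply/orP.
rewrite (distE conn) -greenK !lee_fin lte_fin ltr0n => /andP[-> _].
by split.
Qed.

Let markov_op_green_fin x y :
  markov_op a (green_fin ^~ y) x = green_fin x y - (x == y)%:R.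
Proof.
have := green_first_step hX x y; rewrite -greenK.
under eq_bigr do rewrite -greenK -EFinM.
by rewrite sumEFin -EFinD => -[->]; rewrite addrAC subrr add0r.
Qed.

Let powR_scale_ge (D : R) (m n : nat) : 0 <= D -> (0 < m <= n)%N ->
  D / n%:R `^ gamma <= D / m%:R `^ gamma.
Proof.
move=> D0 /andP[m0 mn]; rewrite ler_wpM2l // lef_pV2 ?posrE ?powR_gt0 ?ltr0n //.
  by rewrite ge0_ler_powR ?nnegrE ?ler_nat // ltW.
exact: leq_trans mn.
Qed.

Lemma green_estimate_weak_harnack : weak_harnack a (2 `^ gamma * (Cs / Ci)).
Proof.
have Cs_gt0 : 0 < Cs by exact: lt_le_trans Ci_le_Cs.
have C_ge1 : 1 <= 2 `^ gamma * (Cs / Ci).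
  rewrite -[1]mulr1 ler_pM // ?ler_pdivlMr ?mul1r //.
  by rewrite -[leLHS](powRr0 2) ler_powR ?ler1n // ltW.
split=> // x r r0.
have [n0 rn0] : exists n0 : nat, r < n0%:R.
  by exists (Num.truncn r).+1; exact: truncnS_gt.
have n0_gt0 : (0 < n0)%N by rewrite -(ltr0n R) (lt_trans r0).
have [m1 m1P] := finite_set_ubound rad (finite_graph_ball conn x n0).
(* Since [m1] bounds [rad] on the ball of radius [n0], the distance from there to [S], at least
   [N - n0], is in the range of the estimate. The term [4 * n0] gives [N > 3 * n0], that is
   [N + n0 < 2 * (N - n0)]. *)
have [N NE] : exists N, N = (m1 + 4 * n0)%N by exists (m1 + 4 * n0)%N.
pose S := [set y | gd x y = N]%classic.
have finS : finite_set S.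
  by apply: sub_finite_set (finite_graph_ball conn x N.+1) => y /= ->.
have [m2 m2P] := finite_set_ubound rad finS.
(* Distances between the ball of radius [n0] and [S] lie in [[N - n0, N + n0]], so the Green
   function there lies between [Ci / be] and [Cs / al]. *)
pose al : R := (N - n0)%N%:R `^ gamma; pose be : R := (N + n0)%N%:R `^ gamma.
have al_gt0 : 0 < al by rewrite powR_gt0 // ltr0n; lia.
have be_gt0 : 0 < be by rewrite powR_gt0 // ltr0n; lia.
have be_lt : be < 2 `^ gamma * al.
  rewrite -powRM // -natrM.
  by apply: gt0_ltr_powR; rewrite ?nnegrE // ltr_nat; lia.
(* With this choice [Ci / be - eps = Ci / (2 ^ gamma * al)], which makes the final constant exactly
   [2 ^ gamma * (Cs / Ci)]. *)
pose eps := Ci / be - Ci / (2 `^ gamma * al).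
have eps_gt0 : 0 < eps.
  by rewrite subr_gt0 ltr_pM2l // ltf_pV2 // posrE mulr_gt0 // powR_gt0 // ltr0n.
(* Any [K] above [(Cs / eps)] to the power [1 / gamma] brings the upper estimate at distance [K]
   down to [eps]. *)
have [K K_gt0 K_eps] : exists2 K, (0 < K)%N & Cs / K%:R `^ gamma <= eps.
  exists (Num.truncn ((Cs / eps) `^ gamma^-1)).+1 => //.
  have Cs_eps : 0 <= Cs / eps by rewrite divr_ge0 // ltW.
  rewrite ler_pdivrMr ?powR_gt0 // -ler_pdivrMl // mulrC.
  rewrite -[leLHS]powRr1 // -[X in _ `^ X <= _](mulVf (lt0r_neq0 gamma_gt0)).
  rewrite powRrM ge0_ler_powR ?nnegrE ?powR_ge0 ?(ltW gamma_gt0) //.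
  exact/ltW/truncnS_gt.
(* A vertex outside the ball of radius [M] is at distance at least [m2 + K] from [S]: [m2] puts the
   pair in the range of the estimate through the radius at the point of [S], and [K] makes the Green
   function at most [eps]. *)
have [M ME] : exists M, M = (N + m2 + K + n0)%N by exists (N + m2 + K + n0)%N.
have N_lt_M : (N < M)%N by clear -NE ME n0_gt0; lia.
have n0_le_M : (n0 <= M)%N by clear -NE ME n0_gt0; lia.
have n0_le_N : (n0 <= N)%N by clear -NE ME n0_gt0; lia.
exists M%:R; first by rewrite (le_trans (ltW rn0)) // ler_nat.
move=> u upos harm.
pose A := [set y | (gd x y <= N)%N]%classic.
have gballM : gball a x M%:R = [set y | (gd x y < M)%N]%classic.
  by rewrite (gballE conn); apply/seteqP; split=> y /=; rewrite ltr_nat.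
have near y : gball a x r y -> (gd x y < n0)%N.
  by rewrite (gballE conn) /= => yr; rewrite -(ltr_nat R) (lt_trans yr).
have xr : gball a x r x.
  by rewrite (gballE conn) /= graph_distxx.
have main y z : gball a x r y -> gball a x r z ->
    u y <= 2 `^ gamma * (Cs / Ci) * u z.
  move=> /near yn0 /near zn0.
  apply: (@harnack_of_potential_kernel _ _ a green_fin A (gball a x M%:R) S
    u eps) => //.
  - by rewrite gballM; exact: finite_graph_ball.
  - by rewrite gballM => t /leq_ltn_trans; apply.
  - by move=> t; rewrite /S /A /= => ->.
  - exact: le_trans C_ge1.
  (* A vertex of [A] outside [S] is at distance less than [N] from [x], so one step does not leave
     [A]. *)
  - move=> t s tN tnN /(graph_dist_adj conn x) /leq_trans; apply.
    by rewrite ltn_neqAle tN andbT; apply/eqP.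
  - by move=> t s; rewrite fine_ge0 ?green_ge0.
  - move=> t s; rewrite gballM /= => /negP; rewrite -leqNgt => Mt Ss.
    have far : (m2 + K <= gd t s)%N.
      have := graph_dist_triangle conn s x t.
      by rewrite Ss (graph_dist_sym _ s t); clear -ME Mt; lia.
    have [|_ _ /le_trans->//] := green_fin_bounds (x := t) (y := s).
      right; rewrite (le_trans (m2P s Ss)) // ler_nat (leq_trans _ far) //.
      exact: leq_addr.
    apply: le_trans K_eps; apply: powR_scale_ge; first exact: ltW.
    by rewrite K_gt0 (leq_trans _ far) // leq_addl.
  - by move=> t /upos/ltW.
  - exact: leq_trans (ltnW yn0) n0_le_N.
  - exact: leq_trans (ltnW zn0) n0_le_N.
  - move=> s Ss.
    have far t : (gd x t < n0)%N -> (N - n0 <= gd t s <= N + n0)%N.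
      move=> tn0; have := graph_dist_triangle conn t x s; rewrite Ss.
      have := graph_dist_triangle conn x t s; rewrite Ss (graph_dist_sym _ t x).
      by clear -tn0 NE; lia.
    have bounds t : (gd x t < n0)%N ->
        Ci / be <= green_fin t s /\ green_fin t s <= Cs / al.
      move=> tn0; have /andP[ge_ts le_ts] := far t tn0.
      have [|ts_gt0 lo hi] := green_fin_bounds (x := t) (y := s).
        left; rewrite (le_trans (m1P t tn0)) // ler_nat (leq_trans _ ge_ts) //.
        by clear -NE; lia.
      split; [apply: le_trans lo|apply: (le_trans hi)]; apply: powR_scale_ge.
      - exact: ltW.
      - by rewrite ts_gt0.
      - exact: ltW.
      - by rewrite ge_ts andbT; clear -NE n0_gt0; lia.
    have [_ /le_trans] := bounds y yn0; apply.
    have [z_ge _] := bounds z zn0.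
    have -> : Cs / al = 2 `^ gamma * (Cs / Ci) * (Ci / be - eps).
      rewrite /eps; field.
      by rewrite !lt0r_neq0 // powR_gt0 // ltr0n.
    by rewrite ler_wpM2l ?lerB // (le_trans _ C_ge1).
(* Being nonempty, the image has a [sup] below each upper bound and an [inf] above each lower bound,
   so the pointwise inequality suffices. *)
have u_neq0 : u @` gball a x r !=set0 by exists (u x); exists x.
apply: ge_sup => // _ [y yr <-].
rewrite -ler_pdivrMl ?(lt_le_trans _ C_ge1) //.
apply: lb_le_inf => // _ [z zr <-].
by rewrite ler_pdivrMl ?(lt_le_trans _ C_ge1) // main.
Qed.
End GreenEstimate.

Unset Implicit Arguments.

Theorem proposition1p3 (R : realType) (V : countType)
    (a : weighted_graph R V)
    (d : measure_display) (Omega : measurableType d)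
    (P : V -> probability Omega R) (X : nat -> Omega -> V)
    (hX : is_random_walk a P X)
    (gamma Ci Cs : R) (gamma_gt0 : 0 < gamma)
    (Ci_gt0 : 0 < Ci) (Ci_le_Cs : Ci <= Cs)
    (hGE : green_estimate a P X gamma Ci Cs) :
  [/\ graph_connected a,
      transient P X &
      weak_harnack a (2 `^ gamma * (Cs / Ci))].
Proof.
have conn := green_estimate_connected hGE.
have [rad GE] := hGE.
split; first exact: conn.
  exact: (green_estimate_transient hX conn GE).
exact: (green_estimate_weak_harnack hX gamma_gt0 Ci_gt0 Ci_le_Cs conn GE).
Qed.
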